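(* Let $K$ be a compact Hausdorff topological space and $n$ be an even (positive) integer. Then $\{\pm\delta_p^n,\ \delta_t^n-\delta_s^n: p,t,s\in K,\ t\ne s\}$ is equal to the set of weak$^*$ exposed points of the unit ball of $(\mathcal{P}_o(^nC(K)),\|\cdot\|_\infty)$ if and only if $K$ is first countable.
   Context: $C(K)$ is the space of continuous real functions on $K$. An $n$-homogeneous polynomial on $C(K)$ is a function $P(x)=A(x,\dots,x)$ with $A$ a bounded $n$-linear form on $(C(K),\|\cdot\|_\infty)$; it is orthogonally additive if $P(x+y)=P(x)+P(y)$ whenever $|x|\wedge|y|=0$. $\mathcal{P}_o(^nC(K))$ is the space of orthogonally additive $n$-homogeneous polynomials, with norm $\|P\|_\infty=\sup\{|P(x)|:\|x\|_\infty\le1\}$. $\delta_t^n$ is the polynomial $x\mapsto x(t)^n$. Duality: every $P\in\mathcal{P}_o(^nC(K))$ has the form $P(x)=\int_K x^n\,d\mu$ for a unique regular Borel signed measure $\mu$ on $K$, and for $n$ even $\mu\mapsto P$ is an isometric isomorphism of $(\mathcal{M}(K),\|\cdot\|_0)$ onto $(\mathcal{P}_o(^nC(K)),\|\cdot\|_\infty)$, where $\mathcal{M}(K)$ is the space of regular Borel signed measures and $\|\mu\|_0=\max\{\mu^+(K),\mu^-(K)\}$. Moreover $(\mathcal{M}(K),\|\cdot\|_0)$ is the dual of $(C(K),\|\cdot\|_d)$ under $\langle x,\mu\rangle=\int_K x\,d\mu$, where $\|x\|_d=\|x^+\|_\infty+\|x^-\|_\infty$. Via these identifications $\mathcal{P}_o(^nC(K))$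 is regarded as the dual of $(C(K),\|\cdot\|_d)$, and weak$^*$ notions refer to this duality. If $E=F'$ is a dual Banach space, a point $u$ in the closed unit ball $\overline{B}_E$ is a weak$^*$ exposed point of $\overline{B}_E$ if there is $\varphi\in F$ with $\|\varphi\|=1$ such that $\langle\varphi,u\rangle=1$ and $\langle\varphi,v\rangle<1$ for all $v\in\overline{B}_E\setminus\{u\}$. *)

(* Defs.v *)
From HB Require Import structures.
From mathcomp Require Import all_boot all_order all_algebra.
From mathcomp Require Import all_classical all_reals all_analysis.

Set Implicit Arguments.
Unset Strict Implicit.
Unset Printing Implicit Defensive.

Import Order.TTheory GRing.Theory Num.Theory.
Import numFieldNormedType.Exports.

Local Open Scope classical_set_scope.
Local Open Scope ring_scope.

(* [continuousType K R] is equipped with its pointwise R-module structure, as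
   a submodule of [K -> R]. *)
Section continuous_submodule.
Context (K : topologicalType) (R : realType).

Definition cont : {pred K -> R} := mem [set f : K -> R | continuous f].

Definition cont_Sub (f : K -> R) (fP : f \in cont) : continuousType K R :=
  HB.pack_for (continuousType K R) f (@isContinuous.Build K R f (set_mem fP)).

Lemma cont_rect (T : continuousType K R -> Type) :
  (forall f (fP : f \in cont), T (cont_Sub fP)) -> forall u, T u.
Proof.
move=> Ksub [f [[cf]]].
have fP : f \in cont by exact/mem_set.
suff -> : cf = set_mem fP by exact: Ksub.
exact: Prop_irrelevance.
Qed.

Lemma cont_valP (f : K -> R) (fP : f \in cont) : cont_Sub fP = f :> (K -> R).
Proof. by []. Qed.

HB.instance Definition _ :=
  isSub.Build _ _ (continuousType K R) cont_rect cont_valP.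

Lemma cont_submod_closed : submod_closed cont.
Proof.
split; first by apply/mem_set => x; exact: cst_continuous.
move=> a f g /set_mem cf /set_mem cg; apply/mem_set => x.
apply: continuousD; last exact: cg.
by apply: continuousZ; [exact: cst_continuous|exact: cf].
Qed.

HB.instance Definition _ :=
  GRing.isSubmodClosed.Build _ _ cont cont_submod_closed.
HB.instance Definition _ :=
  [SubChoice_isSubLmodule of continuousType K R by <:].

End continuous_submodule.

Section sup_norms.
Context (K : topologicalType) (R : realType).
Implicit Types (f : K -> R) (x : continuousType K R).

Definition sup_norm f : R := sup (range (fun t => `|f t|)).

Definition d_norm x : R := sup_norm x^\+ + sup_norm x^\-.

End sup_norms.

Section orthogonally_additive_polynomials.
Context (K : topologicalType) (R : realType).
Implicit Types (x y : continuousType K R) (P : continuousType K R -> R).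

Definition multilinear n (A : ('I_n -> continuousType K R) -> R) :=
  forall (x : 'I_n -> continuousType K R) (i : 'I_n) (a : R)
         (u v : continuousType K R),
    A (dfwith x i (a *: u + v)) = a * A (dfwith x i u) + A (dfwith x i v).

Definition bounded_form n (A : ('I_n -> continuousType K R) -> R) :=
  exists M : R, forall x : 'I_n -> continuousType K R,
    `|A x| <= M * \prod_(i < n) sup_norm (x i).

Definition homogeneous_polynomial n P :=
  exists A : ('I_n -> continuousType K R) -> R,
    [/\ multilinear A, bounded_form A & forall x, P x = A (fun=> x)].

Definition orthogonally_additive P := forall x y,
  (forall t, Num.min `|x t| `|y t| = 0) -> P (x + y) = P x + P y.

Definition oa_polynomial n : set (continuousType K R -> R) :=
  [set P | homogeneous_polynomial n P /\ orthogonally_additive P].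

Definition poly_norm P : R :=
  sup [set `|P x| | x in [set x : continuousType K R | sup_norm x <= 1]].

Definition oa_closed_ball n : set (continuousType K R -> R) :=
  [set P | oa_polynomial n P /\ poly_norm P <= 1].

Definition delta n (t : K) : continuousType K R -> R := fun x => x t ^+ n.

End orthogonally_additive_polynomials.

Section signed_measures.
Context d (T : measurableType d) (R : realType).
Variable mu : {charge set T -> \bar R}.

Definition hahn_pos : set T := sval (cid (Hahn_decomposition mu)).

Definition hahn_neg : set T := sval (cid (svalP (cid (Hahn_decomposition mu)))).

Definition hahn_posnegP : hahn_decomposition mu hahn_pos hahn_neg :=
  svalP (cid (svalP (cid (Hahn_decomposition mu)))).

Definition charge_integral (f : T -> R) : R :=
  \int[jordan_pos hahn_posnegP]_t f t - \int[jordan_neg hahn_posnegP]_t f t.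

End signed_measures.

(* The library's measurable types are pointed, so the Borel sigma-algebra of a
   topological space is put on a copy of the space that carries a base point
   [x0]; the measurable sets do not depend on [x0]. *)
Definition pointed_at (K : topologicalType) (x0 : K) : Type := K.

HB.instance Definition _ (K : topologicalType) (x0 : K) :=
  Choice.on (pointed_at x0).
HB.instance Definition _ (K : topologicalType) (x0 : K) :=
  isPointed.Build (pointed_at x0) x0.

Notation borel_space x0 :=
  (g_sigma_algebraType (@open _ : set (set (pointed_at x0)))).

Section duality.
Context (K : topologicalType) (R : realType).

Definition regular_charge (x0 : K)
    (mu : {charge set (borel_space x0) -> \bar R}) :=
  forall (A : set (borel_space x0)) (e : R), measurable A -> 0 < e ->
    exists C U : set K, [/\ compact C, open U, C `<=` A, A `<=` U &
      (charge_variation (hahn_posnegP mu) (U `\` C) < e%:E)%E].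

Definition represents n (x0 : K) (mu : {charge set (borel_space x0) -> \bar R})
    (P : continuousType K R -> R) :=
  forall x : continuousType K R, P x = charge_integral mu (fun t => x t ^+ n).

(* <phi, P> = \int phi dmu, where mu is the unique regular signed measure
   representing P. The default 0 is used only when P is not an orthogonally
   additive n-homogeneous polynomial or K is empty; in the latter case every
   integral over K is 0. *)
Definition dual_pairing n (phi : continuousType K R)
    (P : continuousType K R -> R) : R :=
  xget 0 [set r | exists (x0 : K) (mu : {charge set (borel_space x0) -> \bar R}),
    [/\ regular_charge mu, represents n mu P & r = charge_integral mu phi]].

End duality.

(* [E] is a dual of [F] through [pair], and [B] the closed unit ball of [E]. *)
Definition weak_star_exposed (R : realType) (F E : Type) (normF : F -> R)
    (pair : F -> E -> R) (B : set E) : set E :=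
  [set u | B u /\ exists phi : F, [/\ normF phi = 1, pair phi u = 1 &
     forall v, B v -> v <> u -> pair phi v < 1]].

Definition first_countable (T : topologicalType) :=
  forall x : T, exists2 B : set (set T), countable B &
    B `<=` nbhs x /\ forall U, nbhs x U -> exists2 V, B V & V `<=` U.

(* Main.v *)
Require Import Defs.
From mathcomp Require Import all_boot all_order all_algebra.
From mathcomp Require Import all_classical all_reals all_analysis.
From mathcomp Require Import measurable_realfun ring lra.

Set Implicit Arguments.
Unset Strict Implicit.
Unset Printing Implicit Defensive.

Import Order.TTheory GRing.Theory Num.Theory.
Import numFieldNormedType.Exports.

Local Open Scope classical_set_scope.
Local Open Scope ring_scope.

(** Identify an orthogonally additive polynomial P with the functional L f =
    \int f dmu on C(K), where mu represents P. Then P x = L (x ^ n), the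
    pairing of phi with P is L phi, and L can be read off P alone: a
    nonnegative f is an n-th power, so L f = P ((f^+)^(1/n)) - P
    ((f^-)^(1/n)). In particular P lies in the unit ball only if |L f| <= 1
    for 0 <= f <= 1 ([d_dual_ball]), which gives L f <= a + b whenever - b
    <= f <= a. The functional f |-> a f(t) - b f(s) comes from the two-point
    polynomial a x(t)^n - b x(s)^n, represented by the charge a dirac_t - b
    dirac_s. Only represented polynomials matter: an exposed polynomial has
    pairing 1 with its exposing function, hence is represented, while a
    competitor without a representing charge has pairing 0 < 1.

    Exposed points have the stated form. Let phi expose P, with maximum at t
    and minimum at s. Since the positive parts of phi(t) and - phi(s) add up
    to d_norm phi = 1, one of delta_t, - delta_s, delta_t - delta_s also has
    pairing 1 with phi, so it is P ([exposed_two_point]).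

    If delta_t is exposed by phi, then phi(t) = 1 and phi < 1 elsewhere,
    because each delta_s with s <> t has pairing phi(s). By compactness the
    sets phi > 1 - 1/(k+1) form a neighbourhood basis of t
    ([delta_exposed_countable_basis]).

    Conversely, let K be first countable. Each point t is the zero set of
    some continuous g_t >= 0 ([first_countable_zero_set]), so 1 / (1 + g_t)
    peaks at t only, and (g_s - g_t) / (2 (g_s + g_t)) takes its extreme
    values 1/2 and - 1/2 at t and s only. If L in the ball attains a + b at
    a function phi with values in [- b, a], then phi +- c f still has values
    in [- b, a] for small c when f vanishes near the set where phi is a or -
    b, whence L f = 0; by approximation L annihilates every f that vanishes
    on that set ([peak_annihilates]). Hence phi determines L, as evaluation
    at t or as evaluation at t minus evaluation at s ([one_peak],
    [two_peaks]). *)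

(** * Integration against a charge *)

Section charge_integral.
Context d (T : measurableType d) (R : realType).
Implicit Types (m : {finite_measure set T -> \bar R}) (f g : T -> R).

Definition bounded_measurable f :=
  measurable_fun setT f /\ exists M, forall t, `|f t| <= M.

Lemma bounded_measurable_integrable m f :
  bounded_measurable f -> m.-integrable setT (EFin \o f).
Proof.
move=> [mf [M fM]]; apply: measurable_bounded_integrable => //.
  exact: fin_num_fun_lty.
exists M; split; first exact: num_real.
by move=> x Mx t _ /=; rewrite (le_trans (fM t))// ltW.
Qed.

Lemma charge_integral_linear (nu : {charge set T -> \bar R}) a f g :
  bounded_measurable f -> bounded_measurable g ->
  charge_integral nu (fun t => a * f t + g t) =
    a * charge_integral nu f + charge_integral nu g.
Proof.
move=> bf bg.
have lin m : \int[m]_t (a * f t + g t) = a * \int[m]_t f t + \int[m]_t g t.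
  have intf := bounded_measurable_integrable m bf.
  rewrite RintegralD//; first by rewrite RintegralZl.
    under [EFin \o _]eq_fun do rewrite /= EFinM.
    exact: integrableZl.
  exact: bounded_measurable_integrable.
by rewrite /charge_integral !lin; ring.
Qed.

(** The measures m1 + m4 and m3 + m2 agree. This makes the charge integral
    independent of the decomposition of the charge, so it can be computed
    without knowing a Hahn decomposition. *)
Lemma Rintegral_diff m1 m2 m3 m4 f :
  (forall A, measurable A -> m1 A - m2 A = m3 A - m4 A)%E ->
  bounded_measurable f ->
  \int[m1]_t f t - \int[m2]_t f t = \int[m3]_t f t - \int[m4]_t f t.
Proof.
move=> mE bf.
have int m : m.-integrable setT (EFin \o f).
  exact: bounded_measurable_integrable.
have fin m A : measurable A -> m A \is a fin_num by exact: fin_num_measure.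
have eqm A : measurable A -> measure_add m1 m4 A = measure_add m3 m2 A.
  move=> mA; rewrite !measure_addE /=; have := mE A mA.
  rewrite -(fineK (fin m1 _ mA)) -(fineK (fin m2 _ mA)).
  rewrite -(fineK (fin m3 _ mA)) -(fineK (fin m4 _ mA)).
  by rewrite -!EFinB -!EFinD => -[e]; congr EFin; move: e; lra.
have : \int[measure_add m1 m4]_t f t = \int[measure_add m3 m2]_t f t.
  by congr fine; apply: eq_measure_integral => A mA _; exact: eqm.
have add (m m' : {finite_measure set T -> \bar R}) :
    \int[measure_add m m']_t f t = \int[m]_t f t + \int[m']_t f t.
  rewrite /Rintegral integral_measure_add//; [|exact: int..].
  by rewrite fineD//; apply: integrable_fin_num => //; exact: int.
by rewrite !add; lra.
Qed.

Lemma charge_integral_diff (nu : {charge set T -> \bar R}) m1 m2 f :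
  (forall A, measurable A -> nu A = m1 A - m2 A)%E -> bounded_measurable f ->
  charge_integral nu f = \int[m1]_t f t - \int[m2]_t f t.
Proof.
move=> nuE bf; apply: Rintegral_diff => // A mA.
by rewrite -nuE// (jordan_decomp (hahn_posnegP nu) mA) /cadd/= cscaleN1.
Qed.

Lemma Rintegral_mscale_dirac (c : {nonneg R}) (t : T) f :
  bounded_measurable f -> \int[mscale c (dirac t)]_s f s = c%:num * f t.
Proof.
move=> [/measurable_EFinP mF _].
rewrite /Rintegral integralE !ge0_integral_mscale//; last 2 first.
- exact: measurable_funeneg.
- exact: measurable_funepos.
rewrite !integral_dirac//; last 2 first.
- exact: measurable_funeneg.
- exact: measurable_funepos.
rewrite diracT !mul1e funerpos funerneg /= -mulrBr.
by have /(congr1 (@^~ t)) := funrposBneg f; rewrite !fctE => ->.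
Qed.

End charge_integral.

Section borel.
Context (K : topologicalType) (R : realType) (Kcompact : compact [set: K]).

Lemma continuous_bounded (f : K -> R) : continuous f ->
  exists2 M, 0 < M & forall t, `|f t| <= M.
Proof.
move=> cf; have [M [_ fM]] : bounded_set (range f).
  apply: compact_bounded; apply: continuous_compact => //.
  exact: continuous_subspaceT.
exists (`|M| + 1) => [|t]; first by rewrite ltr_wpDl.
by apply: (fM (`|M| + 1)); [rewrite ltr_pwDr// ler_norm|exists t].
Qed.

Lemma open_borel (x0 : K) (U : set K) :
  open U -> measurable (U : set (borel_space x0)).
Proof. by move=> oU; apply: sub_sigma_algebra. Qed.

Lemma continuous_bounded_measurable (x0 : K) (f : K -> R) :
  continuous f -> bounded_measurable (f : borel_space x0 -> R).
Proof.
move=> cf; split.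
  apply: (measurability _ (RGenOpens.measurableE R)).
  move=> _ [_ [a [b ->] <-]]; rewrite setTI; apply: open_borel.
  by move/continuousP: cf; apply; exact: interval_open.
by have [M _ fM] := continuous_bounded cf; exists M.
Qed.

End borel.

(** * The unit ball of the dual of C(K) for the d-norm *)

Section d_dual_ball.
Context (K : topologicalType) (R : realType).
Implicit Types (f g phi : K -> R) (L : (K -> R) -> R).

Lemma continuous_scale (a : R) f :
  continuous f -> continuous (fun t => a * f t).
Proof.
by move=> cf x; apply: (@continuousM R K); [exact: cst_continuous|exact: cf].
Qed.

Lemma continuous_linear_comb (a b : R) f g : continuous f -> continuous g ->
  continuous (fun t => a * f t + b * g t).
Proof.
move=> cf cg x; apply: (@continuousD R R^o K); exact: continuous_scale.
Qed.

Lemma continuous_funrpos f : continuous f -> continuous f^\+.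
Proof.
by move=> cf x; apply: continuous_max; [exact: cf|exact: cst_continuous].
Qed.

Lemma continuous_funrneg f : continuous f -> continuous f^\-.
Proof.
move=> cf; rewrite -funrposN; apply: continuous_funrpos => x.
by apply: (@continuousN R R^o K); exact: cf.
Qed.

(** Linear functionals of norm at most 1 for [d_norm]; the d-norm is the largest
    norm for which the functions with values in [0, 1] have norm at most 1, so
    the bound is only asked on those. Functionals act on bare functions, which
    lets charge integrals be used directly. *)
Definition d_dual_ball L :=
  (forall a f g, continuous f -> continuous g ->
     L (fun t => a * f t + g t) = a * L f + L g) /\
  (forall f, continuous f -> (forall t, 0 <= f t <= 1) -> `|L f| <= 1).

Lemma d_dual_ball0 L : d_dual_ball L -> L (fun=> 0) = 0.
Proof.
move=> [lin _]; have c0 : continuous (fun _ : K => 0 : R).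
  by move=> x; exact: cst_continuous.
have := lin (-1) _ _ c0 c0; under [fun t => _]eq_fun do rewrite mulr0 addr0.
by lra.
Qed.

Lemma d_dual_ballZ L a f : d_dual_ball L -> continuous f ->
  L (fun t => a * f t) = a * L f.
Proof.
move=> BL cf; have c0 : continuous (fun _ : K => 0 : R).
  by move=> x; exact: cst_continuous.
have := BL.1 a _ _ cf c0; rewrite (d_dual_ball0 BL) addr0 => <-.
by congr L; apply/funext => t; rewrite addr0.
Qed.

Lemma d_dual_ballD L a b f g : d_dual_ball L -> continuous f -> continuous g ->
  L (fun t => a * f t + b * g t) = a * L f + b * L g.
Proof.
move=> BL cf cg; rewrite -(d_dual_ballZ b BL cg) -BL.1//.
exact: continuous_scale.
Qed.

Lemma d_dual_ballN L : d_dual_ball L -> d_dual_ball (fun f => - L f).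
Proof.
move=> [lin bnd]; split => [a f g cf cg|f cf f01]; last by rewrite normrN bnd.
by rewrite lin//; ring.
Qed.

Lemma d_dual_ball_norm L c f : d_dual_ball L -> continuous f ->
  (forall t, 0 <= f t <= c) -> 0 <= c -> `|L f| <= c.
Proof.
move=> BL cf fc; rewrite le_eqVlt => /predU1P[c0|c0].
  suff -> : f = fun=> 0 by rewrite d_dual_ball0// normr0 c0.
  by apply/funext => t; have := fc t; rewrite -c0; lra.
have cg : continuous (fun t => c^-1 * f t).
  exact: continuous_scale.
have -> : f = fun t => c * (c^-1 * f t).
  by apply/funext => t; rewrite mulVKf// gt_eqF.
rewrite d_dual_ballZ// normrM gtr0_norm// -[leRHS]mulr1 ler_pM2l//.
apply: BL.2 => // t; have /andP[f0 fc'] := fc t.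
apply/andP; split; first by rewrite mulr_ge0// invr_ge0 ltW.
by rewrite ler_pdivrMl// mulr1.
Qed.

Lemma d_dual_ball_le L a b f : d_dual_ball L -> continuous f ->
  0 <= a -> 0 <= b -> (forall t, - b <= f t <= a) -> L f <= a + b.
Proof.
move=> BL cf a0 b0 fab.
have cp := continuous_funrpos cf; have cn := continuous_funrneg cf.
have -> : L f = L f^\+ - L f^\-.
  rewrite -mulN1r -[L f^\+]mul1r -d_dual_ballD//; congr L.
  by rewrite -[LHS]funrposBneg; apply/funext => t /=; rewrite mul1r mulN1r.
have Lp : `|L f^\+| <= a.
  apply: d_dual_ball_norm => // t; rewrite funrpos_ge0/= ge_max a0 andbT.
  by have /andP[] := fab t.
have Ln : `|L f^\-| <= b.
  apply: d_dual_ball_norm => // t; rewrite funrneg_ge0/= ge_max b0 andbT.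
  by rewrite lerNl; have /andP[] := fab t.
by move: Lp Ln; rewrite !ler_norml => /andP[_ ?] /andP[? _]; lra.
Qed.

Context (Kcompact : compact [set: K]).

(** With g = (f - e)^+, the set where f >= e is compact and phi stays away from
    a and - b on it, so phi +- c g keeps its values in [- b, a] for a small
    c > 0. Then [d_dual_ball_le] bounds L (phi +- c g) by a + b = L phi, which
    forces L g = 0, and f is within e of g. *)
Lemma peak_annihilates_ge0 L a b phi f : d_dual_ball L -> continuous phi ->
  0 <= a -> 0 <= b -> (forall t, - b <= phi t <= a) -> L phi = a + b ->
  continuous f -> (forall t, 0 <= f t) ->
  (forall t, phi t = a \/ phi t = - b -> f t = 0) -> L f = 0.
Proof.
move=> BL cphi a0 b0 phiab Lphi cf f0 fpeak.
have [M M0 fnM] := continuous_bounded Kcompact cf.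
have fM t : f t <= M := le_trans (ler_norm _) (fnM t).
pose one : K -> R := fun=> 1.
have cone : continuous one by move=> x; exact: cst_continuous.
suff small e : 0 < e -> `|L f| <= e.
  apply/eqP; rewrite -normr_eq0 eq_le normr_ge0 andbT.
  by apply/ler_addgt0Pl => e /small; rewrite addr0.
move=> e0.
pose g := (fun t => 1 * f t + (- e) * one t)^\+.
have cg : continuous g.
  by apply: continuous_funrpos; exact: continuous_linear_comb.
have gE t : g t = Num.max (f t - e) 0 by rewrite /g /funrpos mul1r mulr1.
have [eta eta0 phig] : exists2 eta, 0 < eta &
    forall t, 0 < g t -> - b + eta <= phi t <= a - eta.
  pose A := [set t | e <= f t].
  have [A0|/set0P A0] := eqVneq A set0.
    exists 1 => // t; rewrite gE lt_max ltxx orbF subr_gt0 => et.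
    by have : A t := ltW et; rewrite A0.
  have cA : compact A.
    apply: (subclosed_compact _ Kcompact) => //.
    exact: ((continuous_closedP f).1 cf [set y | e <= y] (@closed_ge R e)).
  have cw (h : K -> R) : continuous h -> {within A, continuous h}.
    exact: continuous_subspaceT.
  have cNphi : continuous (fun t => - phi t).
    by move=> x; apply: (@continuousN R R^o K); exact: cphi.
  have [u /set_mem Au umax] := compact_EVT_max A0 cA (cw _ cphi).
  have [v /set_mem Av vmax] := compact_EVT_max A0 cA (cw _ cNphi).
  have strict t : A t -> - b < phi t < a.
    move=> At; have /andP[bt ta] := phiab t; rewrite !lt_neqAle bt ta !andbT.
    apply/andP; split; apply/eqP => et; have := fpeak t; move: At;
      rewrite /A/=; move=> + h.
      by rewrite h; [rewrite leNgt e0|right].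
    by rewrite h; [rewrite leNgt e0|left].
  have /andP[_ ua] := strict _ Au; have /andP[bv _] := strict _ Av.
  exists (Num.min (a - phi u) (phi v + b)) => [|t].
    by rewrite lt_min; apply/andP; split; lra.
  rewrite gE lt_max ltxx orbF subr_gt0 => /ltW At.
  have := umax t (mem_set At); have := vmax t (mem_set At) => /= h1 h2.
  set eta := Num.min _ _; have : eta <= a - phi u by rewrite ge_min lexx.
  have : eta <= phi v + b by rewrite ge_min lexx orbT.
  by move=> ? ?; apply/andP; split; lra.
have gM t : 0 <= g t <= M.
  by rewrite gE le_max lexx orbT/= ge_max (ltW M0) andbT; have := fM t; lra.
have Lg : L g = 0.
  pose c := eta / M.
  have c0 : 0 < c by rewrite divr_gt0.
  have cgeta t : c * g t <= eta.
    by rewrite /c mulrAC ler_pdivrMr// ler_pM2l//; have /andP[] := gM t.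
  have pert s : `|s| = 1 -> s * (c * L g) <= 0.
    move=> s1.
    have : L (fun t => 1 * phi t + (s * c) * g t) <= a + b.
      apply: d_dual_ball_le => //; first exact: continuous_linear_comb.
      move=> t; have /andP[g0 _] := gM t.
      have cgt0 : 0 <= c * g t by rewrite mulr_ge0// ltW.
      have scg : `|s * c * g t| <= eta.
        by rewrite -mulrA normrM s1 mul1r ger0_norm ?cgeta.
      move: scg; rewrite ler_norml => /andP[s1l s1r].
      have [g00|gpos] := eqVneq (g t) 0.
        by rewrite g00 mulr0 addr0 mul1r.
      have /phig/andP[h1 h2] : 0 < g t by rewrite lt_neqAle eq_sym gpos.
      by rewrite mul1r; apply/andP; split; lra.
    by rewrite d_dual_ballD// mul1r Lphi -mulrA; lra.
  have := pert 1 (normr1 _); have := pert (-1); rewrite normrN1 => /(_ erefl).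
  rewrite mul1r mulN1r => h1 h2; have /eqP : c * L g = 0 by lra.
  by rewrite mulf_eq0 gt_eqF//= => /eqP.
have ch : continuous (fun t => 1 * f t + (-1) * g t).
  exact: continuous_linear_comb.
have -> : L f = L (fun t => 1 * f t + (-1) * g t).
  by rewrite d_dual_ballD// Lg mulr0 addr0 mul1r.
apply: d_dual_ball_norm => //; last exact: ltW.
move=> t; rewrite gE mul1r mulN1r; have := f0 t.
by have [h|h] := leP (f t - e) 0; move=> ?; apply/andP; split; lra.
Qed.

Lemma peak_annihilates L a b phi f : d_dual_ball L -> continuous phi ->
  0 <= a -> 0 <= b -> (forall t, - b <= phi t <= a) -> L phi = a + b ->
  continuous f -> (forall t, phi t = a \/ phi t = - b -> f t = 0) -> L f = 0.
Proof.
move=> BL cphi a0 b0 phiab Lphi cf fpeak.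
have cp := continuous_funrpos cf; have cn := continuous_funrneg cf.
have -> : f = fun t => 1 * f^\+ t + (-1) * f^\- t.
  by rewrite -[LHS]funrposBneg; apply/funext => t /=; rewrite mul1r mulN1r.
rewrite d_dual_ballD//.
rewrite (peak_annihilates_ge0 BL cphi a0 b0 phiab Lphi cp) ?mulr0 ?add0r.
- rewrite (peak_annihilates_ge0 BL cphi a0 b0 phiab Lphi cn) ?mulr0 ?add0r//.
  by move=> t; move=> /fpeak ft; rewrite /funrneg ft oppr0 maxxx.
- by [].
- by move=> t /fpeak ft; rewrite /funrpos ft maxxx.
Qed.

End d_dual_ball.

(** * Polynomials in the unit ball and their functionals *)

Section sup_norm.
Context (K : topologicalType) (R : realType).
Context (Kcompact : compact [set: K]).
Implicit Types f : K -> R.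

Lemma norm_le_sup_norm f t : continuous f -> `|f t| <= sup_norm f.
Proof.
move=> cf; apply: ub_le_sup; last by exists t.
by have [M _ fM] := continuous_bounded Kcompact cf; exists M => _ [s _ <-].
Qed.

Lemma sup_norm_le f (t0 : K) M : (forall t, `|f t| <= M) -> sup_norm f <= M.
Proof. by move=> fM; apply: ge_sup; [exists `|f t0|, t0|move=> _ [t _ <-]]. Qed.

Lemma sup_norm_ge0 f : continuous f -> 0 <= sup_norm f.
Proof.
move=> cf; have [[t _]|K0] := pselect (exists t : K, True).
  exact: le_trans (norm_le_sup_norm t cf).
rewrite /sup_norm; have -> : range (fun t => `|f t|) = set0.
  by rewrite -subset0 => r [t _ _]; case: K0; exists t.
by rewrite sup0.
Qed.

End sup_norm.

Section representation.
Context (K : topologicalType) (R : realType) (n : nat).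
Context (Kcompact : compact [set: K]) (n_gt0 : (0 < n)%N).
Implicit Types (f phi : K -> R) (P : continuousType K R -> R).

(** Away from the zeros of f this is differentiability of the power on the
    positive reals; at a zero, f < e^(1/p) gives f^p < e. *)
Lemma continuous_powR f (p : R) : 0 < p -> continuous f ->
  (forall t, 0 <= f t) -> continuous (fun t => f t `^ p).
Proof.
move=> p0 cf f0 t; have [ft0|ft0] := eqVneq (f t) 0; last first.
  apply: (@continuous_comp _ _ _ f (fun a => a `^ p)); first exact: cf.
  apply: differentiable_continuous; apply/derivable1_diffP.
  by apply: derivable_powR; rewrite in_itv/= andbT lt_neqAle eq_sym ft0 f0.
apply/cvgrPdist_lt => e e0; rewrite ft0 powR0 ?gt_eqF//.
have d0 : 0 < e `^ p^-1 by exact: powR_gt0.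
have /cvgrPdist_lt/(_ _ d0) := cf t; apply: filterS => s.
rewrite ft0 !sub0r !normrN !ger0_norm ?powR_ge0// => fse.
rewrite -[ltRHS](@powRr1 _ e) ?ltW// -(@mulVf _ p) ?gt_eqF// powRrM.
by apply: gt0_ltr_powR => //; rewrite nnegrE ?powR_ge0.
Qed.

Lemma nth_root f : continuous f -> (forall t, 0 <= f t) ->
  exists x : continuousType K R, forall t, 0 <= x t /\ x t ^+ n = f t.
Proof.
move=> cf f0.
have cr : continuous (fun t => f t `^ n%:R^-1).
  by apply: continuous_powR => //; rewrite invr_gt0 ltr0n.
exists (cont_Sub (mem_set cr : (fun t => f t `^ n%:R^-1) \in @cont K R)) => t.
rewrite cont_valP powR_ge0; split => //.
by rewrite -powR_mulrn ?powR_ge0// -powRrM mulVf ?powRr1// pnatr_eq0 -lt0n.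
Qed.

(** Boundedness of the multilinear form is what makes the supremum in
    [poly_norm] a genuine upper bound. *)
Lemma homogeneous_polynomial_norm P (x : continuousType K R) :
  homogeneous_polynomial n P -> sup_norm x <= 1 -> `|P x| <= poly_norm P.
Proof.
move=> [A [_ [M AM] PA]] x1; apply: ub_le_sup; last by exists x.
exists `|M| => _ [y y1 <-]; rewrite PA (le_trans (AM _))//.
have y0 : 0 <= sup_norm y := sup_norm_ge0 Kcompact (@cts_fun _ _ y).
rewrite prodr_const -[leRHS]mulr1.
have yn0 : 0 <= sup_norm y ^+ #|'I_n| by exact: exprn_ge0.
apply: le_trans (ler_wpM2r yn0 (ler_norm M)) _.
by rewrite ler_wpM2l// exprn_ile1.
Qed.

(** A function f with values in [0, 1] is x ^ n with x in the unit ball, so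
    that \int f dmu = P x. *)
Lemma represents_d_dual_ball (x0 : K)
    (mu : {charge set (borel_space x0) -> \bar R}) P :
  oa_closed_ball n P -> represents n mu P -> d_dual_ball (charge_integral mu).
Proof.
move=> [[homP _] P1] muP; split => [a f g cf cg|f cf f01].
  by apply: charge_integral_linear; exact: continuous_bounded_measurable.
have [|x xf] := nth_root cf; first by move=> t; have /andP[] := f01 t.
have -> : charge_integral mu f = P x.
  by rewrite muP; congr charge_integral; apply/funext => t; have [] := xf t.
apply: (le_trans _ P1); apply: homogeneous_polynomial_norm => //.
apply: (sup_norm_le (x0 : K)) => t; have [xt0 xtf] := xf t; rewrite ger0_norm//.
by rewrite -(@expr_le1 _ n)// xtf; have /andP[] := f01 t.
Qed.

Lemma charge_integral_funrposneg (x0 : K)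
    (mu : {charge set (borel_space x0) -> \bar R}) f : continuous f ->
  charge_integral mu f = charge_integral mu f^\+ - charge_integral mu f^\-.
Proof.
move=> cf.
have bp := continuous_bounded_measurable Kcompact x0 (continuous_funrpos cf).
have bn := continuous_bounded_measurable Kcompact x0 (continuous_funrneg cf).
rewrite addrC -mulN1r -charge_integral_linear//; congr charge_integral.
by rewrite -[LHS]funrposBneg; apply/funext => t /=; rewrite mulN1r addrC.
Qed.

(** Nonnegative continuous functions are n-th powers, hence their integrals are
    values of P. The base points may differ, as the pairing quantifies over
    them. *)
Lemma represents_unique (x0 x1 : K)
    (mu : {charge set (borel_space x0) -> \bar R})
    (nu : {charge set (borel_space x1) -> \bar R}) P f :
  represents n mu P -> represents n nu P -> continuous f ->
  charge_integral mu f = charge_integral nu f.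
Proof.
move=> muP nuP cf.
rewrite (charge_integral_funrposneg mu cf) (charge_integral_funrposneg nu cf).
have eq0 (g : K -> R) : continuous g -> (forall t, 0 <= g t) ->
    charge_integral mu g = charge_integral nu g.
  move=> cg /(nth_root cg)[x xg].
  have gE : g = fun t => x t ^+ n by apply/funext => t; have [] := xg t.
  by rewrite gE -[LHS]muP -nuP.
by rewrite !eq0//; [exact: continuous_funrneg|exact: continuous_funrpos].
Qed.

Lemma dual_pairingE (x0 : K) (mu : {charge set (borel_space x0) -> \bar R}) P
    (phi : continuousType K R) :
  regular_charge mu -> represents n mu P ->
  dual_pairing n phi P = charge_integral mu phi.
Proof.
move=> rmu muP; rewrite /dual_pairing; set S := [set r | _].
have /xgetPex /= : exists r, S r by exists (charge_integral mu phi), x0, mu.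
move=> /(_ 0) [x1 [nu [_ nuP ->]]].
by apply: (represents_unique nuP muP); exact: cts_fun.
Qed.

Lemma dual_pairing_neq0 P (phi : continuousType K R) :
  dual_pairing n phi P <> 0 ->
  exists x0 (mu : {charge set (borel_space x0) -> \bar R}),
    regular_charge mu /\ represents n mu P.
Proof.
move=> P0; apply: contrapT => noP; apply: P0.
apply: xgetPN => r [x0 [mu [rmu muP _]]].
by apply: noP; exists x0, mu.
Qed.

End representation.

(** * Two-point polynomials *)

Section two_point.
Context (K : topologicalType) (R : realType) (n : nat).
Context (Kcompact : compact [set: K]) (n_gt0 : (0 < n)%N).
Implicit Types (phi x y : continuousType K R).

(** Covers delta_t, - delta_s and delta_t - delta_s uniformly; nonnegative
    weights make a dirac_t and b dirac_s measures. *)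
Definition two_point (a b : {nonneg R}) (t s : K) : continuousType K R -> R :=
  fun x => a%:num * x t ^+ n - b%:num * x s ^+ n.

Lemma delta_two_point t s : delta n t = two_point 1%:nng 0%:nng t s.
Proof. by apply/funext => x; rewrite /two_point /= mul0r mul1r subr0. Qed.

Lemma opp_delta_two_point t s : - delta n s = two_point 0%:nng 1%:nng t s.
Proof. by apply/funext => x; rewrite /two_point /= mul0r mul1r sub0r. Qed.

Lemma delta_sub_two_point t s :
  delta n t - delta n s = two_point 1%:nng 1%:nng t s.
Proof. by apply/funext => x; rewrite /two_point /= !mul1r. Qed.

Lemma prod_dfwith_linear (x : 'I_n -> continuousType K R) i a u v t :
  \prod_j dfwith x i (a *: u + v) j t =
  a * \prod_j dfwith x i u j t + \prod_j dfwith x i v j t.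
Proof.
have prodE w : \prod_j dfwith x i w j t = w t * \prod_(j | j != i) x j t.
  rewrite (bigD1 i)//= dfwithin; congr *%R; apply: eq_bigr => j ji.
  by rewrite dfwithout// eq_sym.
by rewrite !prodE /= mulrDl mulrA.
Qed.

Lemma two_point_homogeneous a b t s :
  homogeneous_polynomial n (two_point a b t s).
Proof.
exists (fun x : 'I_n -> continuousType K R =>
  a%:num * \prod_j x j t - b%:num * \prod_j x j s); split.
- by move=> x i c u v; rewrite !prod_dfwith_linear; ring.
- exists (a%:num + b%:num) => x.
  have le r : `|\prod_j x j r| <= \prod_(j < n) sup_norm (x j).
    rewrite normr_prod; apply: ler_prod => j _; rewrite normr_ge0/=.
    by apply: norm_le_sup_norm => //; exact: cts_fun.
  apply: le_trans (ler_normB _ _) _; rewrite !normrM mulrDl.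
  by apply: lerD; rewrite ger0_norm// ler_wpM2l.
- by move=> x; rewrite /two_point !prodr_const card_ord.
Qed.

Lemma two_point_orthogonally_additive a b t s :
  orthogonally_additive (two_point a b t s).
Proof.
move=> x y xy; have z : 0 ^+ n = 0 :> R by rewrite expr0n gtn_eqF.
have add r : (x + y) r ^+ n = x r ^+ n + y r ^+ n.
  have -> : (x + y) r = x r + y r by []; have := xy r.
  rewrite /Num.min; case: ifPn => _ /eqP; rewrite normr_eq0 => /eqP ->.
    by rewrite z !add0r.
  by rewrite z !addr0.
by rewrite /two_point !add; ring.
Qed.

Lemma two_point_closed_ball a b t s : ~~ odd n -> a%:num <= 1 -> b%:num <= 1 ->
  oa_closed_ball n (two_point a b t s).
Proof.
move=> n_even a1 b1; split; first split.
- exact: two_point_homogeneous.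
- exact: two_point_orthogonally_additive.
apply: ge_sup.
  exists `|two_point a b t s 0|, 0 => //=.
  by apply: (sup_norm_le t) => r; rewrite normr0.
move=> _ [x /= x1 <-].
have x01 r : 0 <= x r ^+ n <= 1.
  rewrite exprn_even_ge0//= -(ger0_norm (exprn_even_ge0 _ n_even)) normrX.
  rewrite exprn_ile1// (le_trans _ x1)//.
  by apply: norm_le_sup_norm => //; exact: cts_fun.
rewrite /two_point ler_norml.
have /andP[t0 t1] := x01 t; have /andP[s0 s1] := x01 s.
have : 0 <= a%:num * x t ^+ n <= 1 by rewrite mulr_ge0//= mulr_ile1.
have : 0 <= b%:num * x s ^+ n <= 1 by rewrite mulr_ge0//= mulr_ile1.
by move=> /andP[? ?] /andP[? ?]; apply/andP; split; lra.
Qed.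

Definition two_point_charge (x0 : K) (a b : {nonneg R}) (t s : K) :
    {charge set (borel_space x0) -> \bar R} :=
  cadd (charge_of_finite_measure (mscale a (@dirac _ (borel_space x0) t R)))
    (copp (charge_of_finite_measure
       (mscale b (@dirac _ (borel_space x0) s R)))).

Lemma two_point_charge_integral (x0 : K) a b t s (f : K -> R) : continuous f ->
  charge_integral (two_point_charge x0 a b t s) f =
  a%:num * f t - b%:num * f s.
Proof.
move=> cf; have bf := continuous_bounded_measurable Kcompact x0 cf.
pose dir r : {finite_measure set (borel_space x0) -> \bar R} :=
  @dirac _ (borel_space x0) r R.
rewrite (@charge_integral_diff _ _ _ _ (mscale a (dir t)) (mscale b (dir s)))//.
by rewrite !Rintegral_mscale_dirac.
Qed.

Lemma continuous_exprn (f : K -> R) :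
  continuous f -> continuous (fun t => f t ^+ n).
Proof. 
move=> cf t.
apply: (@continuous_comp _ _ _ f (fun a => a ^+ n)); first exact: cf.
exact: exprn_continuous.
 Qed.

Lemma two_point_represents (x0 : K) a b t s :
  represents n (two_point_charge x0 a b t s) (two_point a b t s).
Proof.
move=> x; rewrite two_point_charge_integral//.
by apply: continuous_exprn; exact: cts_fun.
Qed.

(** The charge lives on the finite set {t, s}, so A is approximated from inside
    by its trace on {t, s} and from outside by the complement of the rest of
    {t, s}. *)
Lemma two_point_regular (x0 : K) a b t s : hausdorff_space K ->
  regular_charge (two_point_charge x0 a b t s).
Proof.
move=> Khausdorff A e mA e0.
have fin (B : set K) : B `<=` [set t; s] -> finite_set B.
  by move=> /sub_finite_set; apply.
exists (A `&` [set t; s]), (~` ([set t; s] `\` A)); split.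
- by apply/finite_compact/fin; exact: subIsetr.
- apply: closed_openC; apply: (accessible_finite_set_closed.1 _).
    exact: hausdorff_accessible.
  by apply: fin; exact: subDsetl.
- exact: subIsetl.
- by move=> r Ar /= [_]; apply.
(* The variation vanishes on D because the charge vanishes on its subsets. *)
set D := _ `\` _.
have Dts r : D r -> ~ [set t; s] r.
  move=> [h1 h2] rts; apply: h2; split => //.
  by apply: contrapT => Ar; apply: h1.
have nu0 (B : set K) : B `<=` D -> two_point_charge x0 a b t s B = 0%E.
  move=> BD; have Bt : t \notin B by apply/negP => /set_mem/BD/Dts; apply; left.
  have Bs : s \notin B by apply/negP => /set_mem/BD/Dts; apply; right.
  rewrite /two_point_charge/= /cadd/= /copp/=.
  rewrite /charge_of_finite_measure /mscale/=.
  by rewrite /dirac !indicE (negbTE Bt) (negbTE Bs) !mule0 /= mulr0 oppr0 adde0.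
have -> : charge_variation (hahn_posnegP (two_point_charge x0 a b t s)) D = 0%E.
  rewrite /charge_variation/= jordan_posE jordan_negE cjordan_posE cjordan_negE.
  rewrite /crestr0 /crestr; case: ifPn => _; last by rewrite oppe0 adde0.
  by rewrite !nu0 ?oppe0 ?adde0//; exact: subIsetl.
by rewrite lte_fin.
Qed.

Lemma dual_pairing_two_point a b t s phi : hausdorff_space K ->
  dual_pairing n phi (two_point a b t s) = a%:num * phi t - b%:num * phi s.
Proof.
move=> Khausdorff.
have reg := @two_point_regular t a b t s Khausdorff.
rewrite (dual_pairingE Kcompact n_gt0 _ reg).
  by apply: two_point_charge_integral; exact: cts_fun.
exact: two_point_represents.
Qed.

End two_point.

(** * Peaks determine the functional *)

Section peaks.
Context (K : topologicalType) (R : realType).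
Context (Kcompact : compact [set: K]).
Implicit Types (f phi : K -> R) (L : (K -> R) -> R).

(** The function f - f(t) phi vanishes at the only peak. Positivity of phi is
    essential: a zero of phi is also an extremal value, as - b = 0, and L could
    carry negative mass there. *)
Lemma one_peak L phi t f : d_dual_ball L -> continuous phi ->
  (forall r, 0 < phi r <= 1) -> phi t = 1 -> (forall r, phi r = 1 -> r = t) ->
  L phi = 1 -> continuous f -> L f = f t.
Proof.
move=> BL cphi phi01 phit peak Lphi cf.
have : L (fun r => 1 * f r + (- f t) * phi r) = 0.
  apply: (peak_annihilates Kcompact BL cphi ler01 (lexx 0)).
  - by move=> r; have /andP[/ltW phi0 phi1] := phi01 r; rewrite oppr0 phi0.
  - by rewrite addr0.
  - exact: continuous_linear_comb.
  - move=> r [/peak ->|/eqP]; first by rewrite phit; ring.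
    by rewrite oppr0 gt_eqF//; have /andP[] := phi01 r.
by rewrite d_dual_ballD// Lphi; lra.
Qed.

Lemma two_peaks L phi t s f : d_dual_ball L -> continuous phi ->
  (forall r, - 2^-1 <= phi r <= 2^-1) -> phi t = 2^-1 -> phi s = - 2^-1 ->
  (forall r, phi r = 2^-1 -> r = t) -> (forall r, phi r = - 2^-1 -> r = s) ->
  L phi = 1 -> continuous f -> L f = f t - f s.
Proof.
move=> BL cphi phiB phit phis peakt peaks Lphi cf.
have c1 : continuous (fun _ : K => 1 : R) by move=> x; exact: cst_continuous.
(* Values in [0, 1], equal to (1, 0) and (0, 1) at (t, s). *)
pose h1 r := 1 * phi r + 2^-1 * 1; pose h2 r := (-1) * phi r + 2^-1 * 1.
have ch1 : continuous h1 by exact: continuous_linear_comb.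
have ch2 : continuous h2 by exact: continuous_linear_comb.
have Lh1 : `|L h1| <= 1.
  apply: BL.2 => // r; rewrite /h1; have /andP[? ?] := phiB r.
  by apply/andP; split; lra.
have Lh2 : `|L h2| <= 1.
  apply: BL.2 => // r; rewrite /h2; have /andP[? ?] := phiB r.
  by apply/andP; split; lra.
have Lh12 : L h1 - L h2 = 2.
  rewrite -mulN1r -[L h1]mul1r -d_dual_ballD//.
  rewrite (_ : (fun r => _) = fun r => 2 * phi r) ?d_dual_ballZ ?Lphi ?mulr1//.
  by apply/funext => r; rewrite /h1 /h2; ring.
have [Lh1E Lh2E] : L h1 = 1 /\ L h2 = -1.
  by move: Lh1 Lh2; rewrite !ler_norml => /andP[? ?] /andP[? ?]; split; lra.
pose h r := f t * h1 r + f s * h2 r.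
have ch : continuous h by exact: continuous_linear_comb.
(* h interpolates f at t and s. *)
have : L (fun r => 1 * f r + (-1) * h r) = 0.
  have half0 : 0 <= 2^-1 :> R by [].
  apply: (peak_annihilates Kcompact BL cphi half0 half0) => //.
  - by rewrite Lphi; lra.
  - exact: continuous_linear_comb.
  - by move=> r [/peakt|/peaks] ->; rewrite /h /h1 /h2 ?phit ?phis; lra.
by rewrite d_dual_ballD// d_dual_ballD// Lh1E Lh2E; lra.
Qed.

(** The bounds a = 0 and b = 0 need not be attained: a positive or negative part
    has norm 0 when it vanishes. *)
Lemma d_normE (phi : continuousType K R) (t0 : K) (a b : R) :
  0 <= a -> 0 <= b -> (forall t, - b <= phi t <= a) ->
  a = 0 \/ (exists t, phi t = a) ->
  b = 0 \/ (exists t, phi t = - b) -> d_norm phi = a + b.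
Proof.
move=> a0 b0 phiab ta tb.
have supE (g : K -> R) (c : R) : continuous g -> (forall t, 0 <= g t <= c) ->
    c = 0 \/ (exists t, g t = c) -> sup_norm g = c.
  move=> cg gc c_att; apply/eqP; rewrite eq_le; apply/andP; split.
    apply: (sup_norm_le t0) => t.
    by have /andP[g0 gt] := gc t; rewrite ger0_norm.
  case: c_att => [->|[t <-]]; first exact: sup_norm_ge0.
  exact: le_trans (ler_norm _) (norm_le_sup_norm _ _ _).
have cphi : continuous phi := @cts_fun _ _ phi.
congr +%R; apply: supE.
- exact: continuous_funrpos.
- by move=> t; have /andP[_ h] := phiab t; rewrite funrpos_ge0/= ge_max h a0.
- by case: ta => [|[t ta]]; [left|right; exists t; rewrite /funrpos ta max_l].
- exact: continuous_funrneg.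
- move=> t; have /andP[h _] := phiab t.
  by rewrite funrneg_ge0/= ge_max b0 lerNl h.
- case: tb => [|[t tb]]; [by left|right; exists t].
  by rewrite /funrneg tb opprK max_l.
Qed.

Lemma d_dual_ball_le_d_norm L (phi : continuousType K R) :
  d_dual_ball L -> L phi <= d_norm phi.
Proof.
move=> BL; have cphi : continuous phi := @cts_fun _ _ phi.
have cp := continuous_funrpos cphi; have cn := continuous_funrneg cphi.
apply: d_dual_ball_le => //; [exact: sup_norm_ge0|exact: sup_norm_ge0|move=> t].
have := norm_le_sup_norm Kcompact t cp; have := norm_le_sup_norm Kcompact t cn.
rewrite !ger0_norm ?funrpos_ge0 ?funrneg_ge0// /funrpos /funrneg !ge_max.
by move=> /andP[? _] /andP[? _]; apply/andP; split; lra.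
Qed.

(** Urysohn functions F_k that vanish at t and are 1 off the k-th basic
    neighbourhood are combined into g = sup_k F_k / (k+1). The weights make the
    tail of the supremum uniformly small, so continuity at a point only involves
    finitely many F_k. *)
Lemma first_countable_zero_set (t : K) : hausdorff_space K ->
  first_countable K ->
  exists g : K -> R, [/\ continuous g, forall s, 0 <= g s &
    forall s, g s = 0 <-> s = t].
Proof.
move=> Khausdorff /(_ t)[B cB [Bt Bbase]].
have [rk rkinj] := elimT (countable_injP B) cB.
pose V k := xget setT [set W | B W /\ rk W = k].
have V_nbhs k : nbhs t (V k).
  rewrite /V; case: xgetP => [W _ [BW _]|_]; first exact: Bt.
  exact: filterT.
have VE W : B W -> V (rk W) = W.
  move=> BW; rewrite /V; case: xgetP => [W' _ [BW' rkW']|/(_ W)[]//].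
  by apply: rkinj; rewrite ?inE.
have urysohn k : exists f : K -> R, [/\ continuous f,
    forall s, 0 <= f s <= 1, f t = 0 & forall s, ~ V k s -> f s = 1].
  have clt : closed [set t].
    by apply: accessible_closed_set1; exact: hausdorff_accessible.
  have clV : closed (~` (V k)^°) by apply: open_closedC; exact: open_interior.
  have disj : [set t] `&` ~` (V k)^° = set0.
    by rewrite -subset0 => s [-> nV]; apply: nV; exact: V_nbhs.
  have sep := normal_uniform_separator (compact_normal Khausdorff Kcompact)
    clt clV disj.
  have [f [cf f01 ft fV]] := (@uniform_separatorP _ R _ _).1 sep.
  exists f; split => // [s||s nVs].
  - by have := f01 (f s); rewrite /= in_itv/=; apply; exists s.
  - by apply: ft; exists t.
  - by apply: fV; exists s => // /interior_subset.
have [F FP] := choice urysohn.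
pose u k s : R := F k s / k.+1%:R.
have u_ge0 k s : 0 <= u k s.
  by rewrite divr_ge0//; have [_ /(_ s)/andP[]] := FP k.
have u_le k s : u k s <= k.+1%:R^-1.
  by rewrite ler_pdivrMr// mulVf//; have [_ /(_ s)/andP[]] := FP k.
have u_cont k : continuous (u k).
  move=> x; apply: (@continuousM R K); last exact: cst_continuous.
  by have [+ _ _ _] := FP k; apply.
have u_t k : u k t = 0 by rewrite /u; have [_ _ -> _] := FP k; rewrite mul0r.
have u_out k s : ~ V k s -> 0 < u k s.
  by move=> nVs; have [_ _ _ F1] := FP k; rewrite /u F1// divr_gt0.
pose g s := sup (range (u ^~ s)).
have g_ub s : has_ubound (range (u ^~ s)).
  exists 1 => _ [k _ <-]; by rewrite (le_trans (u_le k s))// invf_le1// ler1n.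
have u_le_g k s : u k s <= g s by apply: ub_le_sup => //; exists k.
have g_le s M : (forall k, u k s <= M) -> g s <= M.
  by move=> uM; apply: ge_sup; [exists (u 0%N s), 0%N|move=> _ [k _ <-]].
have g_ge0 s : 0 <= g s := le_trans (u_ge0 0%N s) (u_le_g 0%N s).
exists g; split => // [s|s]; last split=> [gs0|->].
- apply/cvgrPdist_le => e e0.
  have [N Ne] : exists N, N.+1%:R^-1 < e.
    have [N _ /(_ N (leqnn N))] := near_infty_natSinv_lt (PosNum e0).
    by exists N.
  have unear : \forall r \near s, forall k : 'I_N, `|u k s - u k r| <= e.
    apply: filter_forall => k.
    by have /cvgrPdist_le/(_ _ e0) := u_cont k s.
  have tail k r : (N <= k)%N -> u k r <= e.
    move=> Nk; rewrite (le_trans (u_le k r))// (le_trans _ (ltW Ne))//.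
    by rewrite lef_pV2 ?posrE// ler_nat.
  apply: filterS unear => r ur.
  have key x y : (forall k : 'I_N, `|u k x - u k y| <= e) -> g x <= g y + e.
    move=> uxy; apply: g_le => k; have [kN|Nk] := ltnP k N.
      have := uxy (Ordinal kN); rewrite ler_norml /= => /andP[_ ?].
      by have := u_le_g k y; lra.
    by have := tail k x Nk; have := g_ge0 y; lra.
  have h1 := key s r ur.
  have h2 : g r <= g s + e by apply: key => k; rewrite distrC.
  by rewrite ler_norml; apply/andP; split; lra.
- apply: contrapT => st.
  have cls : closed [set s].
    by apply: accessible_closed_set1; exact: hausdorff_accessible.
  have nt : nbhs t (~` [set s]).
    apply: open_nbhs_nbhs; split; first exact: closed_openC.
    by move=> /= ts; apply: st.
  have [W BW Ws] := Bbase _ nt.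
  have nVs : ~ V (rk W) s by rewrite VE// => /Ws /(_ erefl).
  by have := u_le_g (rk W) s; rewrite gs0 leNgt u_out.
- by apply/eqP; rewrite eq_le g_ge0 andbT; apply: g_le => k; rewrite u_t.
Qed.

End peaks.

(** * Exposed points *)

Section exposed.
Context (K : topologicalType) (R : realType) (n : nat).
Context (Kcompact : compact [set: K]) (Khausdorff : hausdorff_space K).
Context (n_gt0 : (0 < n)%N) (n_even : ~~ odd n).
Implicit Types (a b : {nonneg R}).

Local Notation exposed :=
  (weak_star_exposed (@d_norm K R) (@dual_pairing K R n)
     (@oa_closed_ball K R n)).

(** A competitor P with pairing at least 1 has a representing charge, for
    otherwise its pairing is 0; the functional L of that charge then satisfies
    L phi = d_norm phi = 1 and is known on all x ^ n. *)
Lemma two_point_exposed a b t s (phi : continuousType K R) :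
  a%:num <= 1 -> b%:num <= 1 -> d_norm phi = 1 ->
  a%:num * phi t - b%:num * phi s = 1 ->
  (forall L, d_dual_ball L -> L phi = 1 -> forall f : K -> R, continuous f ->
     L f = a%:num * f t - b%:num * f s) ->
  exposed (two_point n a b t s).
Proof.
move=> a1 b1 phi1 pairing uniq; split; first exact: two_point_closed_ball.
exists phi; split => //; first by rewrite dual_pairing_two_point.
move=> P BP Pne; rewrite ltNge; apply/negP => phiP.
have [x0 [mu [rmu muP]]] :
    exists x0 (mu : {charge set (borel_space x0) -> \bar R}),
    regular_charge mu /\ represents n mu P.
  by apply: (dual_pairing_neq0 (phi := phi)) => h; move: phiP; rewrite h ler10.
have BL := represents_d_dual_ball Kcompact n_gt0 BP muP.
apply: Pne; apply/funext => x; rewrite muP /two_point.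
apply: (uniq _ BL) => //; last by apply: continuous_exprn; exact: cts_fun.
apply/eqP; rewrite eq_le -{1}phi1 d_dual_ball_le_d_norm//=.
by rewrite -(dual_pairingE Kcompact n_gt0 phi rmu muP).
Qed.

(** At least one of the extreme values of phi at t and s has the sign that
    counts in [d_norm]; the polynomial is chosen accordingly. *)
Lemma exposed_two_point P : exposed P ->
  exists t s, [\/ P = delta n t, P = - delta n s |
    t <> s /\ P = delta n t - delta n s].
Proof.
move=> [_ [phi [phi1 phiP uniq]]].
have [x0 _] : exists x0 (mu : {charge set (borel_space x0) -> \bar R}),
    regular_charge mu /\ represents n mu P.
  by apply: (dual_pairing_neq0 (phi := phi)); rewrite phiP; exact/eqP/oner_neq0.
have cphi : continuous phi := @cts_fun _ _ phi.
have cNphi : continuous (fun t => - phi t).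
  by move=> x; apply: (@continuousN R R^o K); exact: cphi.
have K0 : [set: K] !=set0 by exists x0.
have [t _ tmax] := compact_EVT_max K0 Kcompact (continuous_subspaceT cphi).
have [s _ smax] := compact_EVT_max K0 Kcompact (continuous_subspaceT cNphi).
have phit r : phi r <= phi t by apply: tmax; rewrite inE.
have phis r : phi s <= phi r by rewrite -lerN2; apply: smax; rewrite inE.
have norm1 : Num.max (phi t) 0 + Num.max (- phi s) 0 = 1.
  rewrite -phi1; symmetry; apply: (d_normE Kcompact x0).
  - by rewrite le_max lexx orbT.
  - by rewrite le_max lexx orbT.
  - by move=> r; rewrite lerNl !le_max lerN2 phit phis.
  - by have [h|h] := leP (phi t) 0; [left|right; exists t].
  - by have [h|h] := leP (- phi s) 0; [left|right; exists s; rewrite opprK].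
have isP a b : a%:num <= 1 -> b%:num <= 1 ->
    a%:num * phi t - b%:num * phi s = 1 -> P = two_point n a b t s.
  move=> a1 b1 ab; apply: contrapT => Pne.
  have ball := two_point_closed_ball Kcompact n_gt0 t s n_even a1 b1.
  have := uniq _ ball (nesym Pne).
  by rewrite dual_pairing_two_point// ab ltxx.
exists t, s.
have [pt|pt] := leP (phi t) 0; last have [ps|ps] := leP (- phi s) 0.
- apply: Or32; rewrite (opp_delta_two_point _ _ t); apply: isP => //=.
  move: norm1; rewrite max_r// mul0r mul1r !add0r => <-.
  by rewrite max_l//; have := phit s; lra.
- apply: Or31; rewrite (delta_two_point _ _ t s); apply: isP => //=.
  by move: norm1; rewrite max_l ?ltW// max_r// addr0 mul0r mul1r subr0.
- apply: Or33; split; first by move=> ts; move: pt ps; rewrite ts; lra.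
  rewrite delta_sub_two_point; apply: isP => //=.
  by move: norm1; rewrite !max_l ?ltW// !mul1r.
Qed.

(** The exposing function has a strict maximum 1 at t, so its maximum on the
    compact complement of an open neighbourhood of t is below 1. *)
Lemma delta_exposed_countable_basis t : exposed (delta n t) ->
  exists2 B : set (set K), countable B &
    B `<=` nbhs t /\ forall U, nbhs t U -> exists2 V, B V & V `<=` U.
Proof.
move=> [_ [phi [_ phit uniq]]].
have pairE r : dual_pairing n phi (delta n r) = phi r.
  by rewrite (delta_two_point _ _ r r) dual_pairing_two_point//=
    mul0r mul1r subr0.
have cphi : continuous phi := @cts_fun _ _ phi.
have phit1 : phi t = 1 by rewrite -pairE.
have phi_lt1 r : r <> t -> phi r < 1.
  move=> rt; rewrite -pairE; apply: uniq.
    by rewrite (delta_two_point _ _ r r); apply: two_point_closed_ball.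
  move=> drt; have cl1 (y : K) : closed [set y].
    by apply: accessible_closed_set1; exact: hausdorff_accessible.
  have disj : [set r] `&` [set t] = set0 by rewrite -subset0 => x [->].
  have sep := normal_uniform_separator (compact_normal Khausdorff Kcompact)
    (cl1 r) (cl1 t) disj.
  have [f [cf _ fr ft]] := (@uniform_separatorP _ R _ _).1 sep.
  pose x : continuousType K R := cont_Sub (mem_set cf : f \in @cont K R).
  have := congr1 (fun P : continuousType K R -> R => P x) drt.
  rewrite /delta /x !cont_valP (fr (f r)); last by exists r.
  rewrite (ft (f t)); last by exists t.
  by rewrite expr0n gtn_eqF//= expr1n => /eqP; rewrite eq_sym oner_eq0.
pose V k := [set r | 1 - k.+1%:R^-1 < phi r].
exists (range V); first exact: card_image_le.
split=> [_ [k _ <-]|U /nbhs_interior tU].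
  apply: open_nbhs_nbhs; split.
    have oU : open [set y : R | 1 - k.+1%:R^-1 < y] by exact: open_gt.
    exact: ((continuousP phi).1 cphi _ oU).
  by rewrite /V/= phit1 gtrBl invr_gt0.
have [A0|/set0P A0] := eqVneq (~` U^°) set0.
  exists (V 0%N); first by exists 0%N.
  move=> r _; apply: interior_subset; apply: contrapT => nU.
  by have : (~` U^°) r by []; rewrite A0.
have cA : compact (~` U^°).
  apply: (subclosed_compact _ Kcompact) => //.
  by apply: open_closedC; exact: open_interior.
have [c /set_mem cU cmax] := compact_EVT_max A0 cA (continuous_subspaceT cphi).
have c1 : 0 < 1 - phi c.
  rewrite subr_gt0; apply: phi_lt1 => ct; apply: cU; rewrite ct.
  exact: nbhs_singleton.
have [k kc] : exists k, k.+1%:R^-1 < 1 - phi c.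
  by have [N _ /(_ N (leqnn N))] := near_infty_natSinv_lt (PosNum c1); exists N.
exists (V k); first by exists k.
move=> r Vr; apply: interior_subset; apply: contrapT => nU.
have phirc : phi r <= phi c := cmax r (mem_set nU).
have := lt_le_trans Vr phirc.
by rewrite ltrBlDr -ltrBlDl ltNge ltW.
Qed.

Context (Kfc : first_countable K).

(** Both d-norms are recorded because phi exposes delta_t while - phi exposes
    - delta_t. *)
Lemma one_peak_function t : exists phi : continuousType K R,
  [/\ d_norm phi = 1, d_norm (- phi) = 1, forall r, 0 < phi r <= 1, phi t = 1 &
    forall r, phi r = 1 -> r = t].
Proof.
have [g [cg g0 gt]] := first_countable_zero_set R Kcompact t Khausdorff Kfc.
have g1 r : 0 < 1 + g r by rewrite ltr_pwDl.
have cphi : continuous (fun r => (1 + g r)^-1).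
  move=> r; apply: (@continuousV R K); first by rewrite gt_eqF.
  by apply: (@continuousD R R^o K); [exact: cst_continuous|exact: cg].
pose phi : continuousType K R :=
  cont_Sub (mem_set cphi : (fun r => (1 + g r)^-1) \in @cont K R).
have phiE r : phi r = (1 + g r)^-1 by rewrite /phi cont_valP.
have phit : phi t = 1 by rewrite phiE (gt t).2// addr0 invr1.
have phi01 r : 0 < phi r <= 1.
  by rewrite phiE invr_gt0 g1 invf_le1// lerDl g0.
exists phi; split => //.
- rewrite (d_normE Kcompact t (a := 1) (b := 0)) ?addr0//.
  + by move=> r; have /andP[/ltW ? ?] := phi01 r; rewrite oppr0; apply/andP.
  + by right; exists t.
  + by left.
- rewrite (d_normE Kcompact t (a := 0) (b := 1)) ?add0r//.
  + move=> r; have /andP[/ltW ? ?] := phi01 r.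
    by rewrite [(- phi) r]/(- phi r) lerN2 oppr_le0; apply/andP.
  + by left.
  + by right; exists t; rewrite [(- phi) t]/(- phi t) phit.
- move=> r; rewrite phiE => /(congr1 GRing.inv); rewrite invrK invr1 => h.
  by apply/gt; lra.
Qed.

Lemma two_peak_function t s : t <> s -> exists phi : continuousType K R,
  [/\ d_norm phi = 1, forall r, - 2^-1 <= phi r <= 2^-1,
    phi t = 2^-1 /\ phi s = - 2^-1,
    forall r, phi r = 2^-1 -> r = t & forall r, phi r = - 2^-1 -> r = s].
Proof.
move=> ts.
have [g [cg g0 gt]] := first_countable_zero_set R Kcompact t Khausdorff Kfc.
have [h [ch h0 hs]] := first_countable_zero_set R Kcompact s Khausdorff Kfc.
have gh r : 0 < h r + g r.
  rewrite lt_neqAle addr_ge0// andbT eq_sym paddr_eq0//.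
  by apply/negP => /andP[/eqP/hs -> /eqP/gt]; exact: nesym.
pose f r := (2^-1 * h r + (- 2^-1) * g r) / (1 * h r + 1 * g r).
have cphi : continuous f.
  move=> r; apply: (@continuousM R K); first exact: continuous_linear_comb.
  apply: (@continuousV R K); first by rewrite !mul1r gt_eqF.
  exact: continuous_linear_comb.
pose phi : continuousType K R := cont_Sub (mem_set cphi : f \in @cont K R).
have phiE r : phi r = f r by rewrite /phi cont_valP.
have fM r : f r * (h r + g r) = 2^-1 * h r - 2^-1 * g r.
  by rewrite /f !mul1r mulNr divfK// gt_eqF.
have fle r : - 2^-1 <= f r <= 2^-1.
  rewrite /f !mul1r ler_pdivlMr// ler_pdivrMr//.
  by have := g0 r; have := h0 r; move=> ? ?; apply/andP; split; lra.
have ft : f t = 2^-1.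
  apply: (mulIf (lt0r_neq0 (gh t))); rewrite fM (gt t).2//; lra.
have fs : f s = - 2^-1.
  apply: (mulIf (lt0r_neq0 (gh s))); rewrite fM (hs s).2//; lra.
exists phi; split.
- rewrite (d_normE Kcompact t (a := 2^-1) (b := 2^-1))//; first by lra.
  + by right; exists t.
  + by right; exists s.
- exact: fle.
- by [].
- by move=> r fr; apply/gt; have := fM r; rewrite -phiE fr; lra.
- by move=> r fr; apply/hs; have := fM r; rewrite -phiE fr; lra.
Qed.

Lemma delta_exposed t : exposed (delta n t).
Proof.
have [phi [phi1 _ phi01 phit peak]] := one_peak_function t.
rewrite (delta_two_point _ _ t t).
apply: (two_point_exposed (phi := phi)) => //=; first by rewrite phit; lra.
move=> L BL Lphi f cf; rewrite mul0r mul1r subr0.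
by apply: (one_peak Kcompact BL _ phi01 phit peak Lphi cf); exact: cts_fun.
Qed.

Lemma opp_delta_exposed t : exposed (- delta n t).
Proof.
have [phi [_ phi1 phi01 phit peak]] := one_peak_function t.
have NphiE r : (- phi) r = - phi r by [].
rewrite (opp_delta_two_point _ _ t).
apply: (two_point_exposed (phi := - phi)) => //.
  by rewrite NphiE phit /=; lra.
move=> L BL Lphi f cf /=; rewrite mul0r mul1r sub0r.
have cphi : continuous phi := @cts_fun _ _ phi.
apply/eqP; rewrite -eqr_oppLR; apply/eqP.
apply: (one_peak Kcompact (d_dual_ballN BL) cphi phi01 phit peak _ cf).
have LN : L (- phi) = -1 * L phi.
  by rewrite -d_dual_ballZ//; congr L; apply/funext => r; rewrite mulN1r.
by rewrite -Lphi LN mulN1r.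
Qed.

Lemma delta_sub_delta_exposed t s : t <> s -> exposed (delta n t - delta n s).
Proof.
move=> ts.
have [phi [phi1 phiB [phit phis] peakt peaks]] := two_peak_function ts.
rewrite delta_sub_two_point.
apply: (two_point_exposed (phi := phi)) => //=; first by rewrite phit phis; lra.
move=> L BL Lphi f cf; rewrite !mul1r.
apply: (two_peaks Kcompact BL _ phiB phit phis peakt peaks Lphi cf).
exact: cts_fun.
Qed.

End exposed.

Theorem proposition8 (R : realType) (K : topologicalType) (n : nat)
  (Kcompact : compact [set: K]) (Khausdorff : hausdorff_space K)
  (n_gt0 : (0 < n)%N) (n_even : ~~ odd n) :
  [set (@delta K R n p) | p in [set: K]] `|` [set - @delta K R n p | p in [set: K]] `|`
    [set P | exists t s : K, t <> s /\ P = @delta K R n t - @delta K R n s]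
  = weak_star_exposed (@d_norm K R) (@dual_pairing K R n) (@oa_closed_ball K R n)
  <-> first_countable K.
Proof.
split=> [eqE t|Kfc].
  apply: (delta_exposed_countable_basis Kcompact Khausdorff n_gt0 n_even (R := R)).
  by rewrite -eqE; left; left; exists t.
apply/seteqP; split=> [P [[[p _ <-]|[p _ <-]]|[t [s [ts ->]]]]|P].
- exact: delta_exposed.
- exact: opp_delta_exposed.
- exact: delta_sub_delta_exposed.
- move=> /(exposed_two_point Kcompact Khausdorff n_gt0 n_even)[t [s [->|->|tsP]]].
  + by left; left; exists t.
  + by left; right; exists s.
  + by right; exists t, s.
Qed.
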